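(* Let $n\ge 3$ and let $S=(s_1,s_2,\ldots)$ be a packing sequence. (i) If $s_1=s_2=1$, then $C_n$ is $\chi_S$-critical if and only if $n$ is odd. (ii) If $s_1=1$ and $s_2=s_3=2$, then $C_n$ is $\chi_S$-critical if and only if $n\in\{3,5\}$. (iii) If $s_1=1$, $2\le s_2\le 3$ and $s_3=3$, then $C_n$ is $\chi_S$-critical if and only if $n\not\equiv 0\pmod 4$.
   Context: All graphs are finite and simple; $C_n$ is the cycle on $n$ vertices. A packing sequence is an infinite non-decreasing sequence $S=(s_1,s_2,\ldots)$ of positive integers. A map $c:V(G)\to\{1,\ldots,m\}$ is an $S$-packing $m$-coloring if for distinct $u,v$, $c(u)=c(v)=i$ implies $d_G(u,v)>s_i$; $\chi_S(G)$ is the least such $m$. $G$ is $\chi_S$-critical if $\chi_S(H)<\chi_S(G)$ for every proper (nonempty) subgraph $H$ of $G$. *)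

(* Defs.v *)
From mathcomp Require Import all_boot.
Set Implicit Arguments.
Unset Strict Implicit.
Unset Printing Implicit Defensive.

Record sgraph := SGraph {
  svertex :> finType;
  sedge : rel svertex;
  sedge_sym : symmetric sedge;
  sedge_irrefl : irreflexive sedge
}.

Definition has_walk (G : sgraph) (u v : G) (k : nat) : bool :=
  [exists p : k.-tuple G, path (@sedge G) u p && (last u p == v)].

(* None stands for the infinite distance between vertices in different
   components. A shortest walk between connected vertices repeats no vertex,
   so its length is less than #|G| and the search below succeeds. *)
Definition gdist (G : sgraph) (u v : G) : option nat :=
  if connect (@sedge G) u v
  then Some (find (has_walk u v) (iota 0 #|G|))
  else None.

Definition gdist_gt (G : sgraph) (u v : G) (s : nat) : bool :=
  if gdist u v is Some d then s < d else true.

(* Sequences and colors are numbered from 0: s_(i+1) is S i, and the color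
   i+1 of {1, ..., m} is the element i of 'I_m. *)
Definition packing_sequence (S : nat -> nat) : Prop :=
  (forall i, 0 < S i) /\ {homo S : i j / i <= j}.

Definition packing_coloring (S : nat -> nat) (G : sgraph) (m : nat)
    (c : {ffun G -> 'I_m}) : bool :=
  [forall u, forall v, (u != v) && (c u == c v) ==> gdist_gt u v (S (c u))].

Definition packing_colorable (S : nat -> nat) (G : sgraph) (m : nat) : bool :=
  [exists c : {ffun G -> 'I_m}, packing_coloring S c].

Lemma packing_colorable_ex (S : nat -> nat) (G : sgraph) :
  exists m, packing_colorable S G m.
Proof.
exists #|G|; apply/existsP; exists [ffun x => enum_rank x].
apply/forallP => u; apply/forallP => v; apply/implyP => /andP[/negP uv].
by rewrite !ffunE => /eqP /enum_rank_inj /eqP.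
Qed.

Definition chiS (S : nat -> nat) (G : sgraph) : nat :=
  ex_minn (packing_colorable_ex S G).

Record subgraph (G : sgraph) := Subgraph {
  sub_verts : {set G};
  sub_edge : rel G;
  sub_edge_sym : symmetric sub_edge;
  sub_edge_in : forall x y, sub_edge x y ->
    [&& x \in sub_verts, y \in sub_verts & sedge x y]
}.

Section SubgraphAsGraph.
Variables (G : sgraph) (H : subgraph G).

Definition sub_rel : rel {x : G | x \in sub_verts H} :=
  fun x y => sub_edge H (val x) (val y).

Lemma sub_rel_sym : symmetric sub_rel.
Proof. by move=> x y; apply: sub_edge_sym. Qed.

Lemma sub_rel_irrefl : irreflexive sub_rel.
Proof.
move=> x; apply/negP => /sub_edge_in/and3P[_ _].
by rewrite sedge_irrefl.
Qed.

Definition graph_of_subgraph : sgraph := SGraph sub_rel_sym sub_rel_irrefl.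
End SubgraphAsGraph.

Definition proper_subgraph (G : sgraph) (H : subgraph G) : bool :=
  (sub_verts H != [set: G])
  || [exists x, exists y, sedge x y && ~~ sub_edge H x y].

Definition chiS_critical (S : nat -> nat) (G : sgraph) : Prop :=
  forall H : subgraph G, sub_verts H != set0 -> proper_subgraph H ->
    chiS S (graph_of_subgraph H) < chiS S G.

(* ordS is the cyclic successor on 'I_n. The condition i != j only matters
   for n = 1, where it removes the loop; the usual cycle is the case n >= 3. *)
Definition cycle_rel (n : nat) : rel 'I_n :=
  fun i j => (i != j) && ((j == ordS i) || (i == ordS j)).

Lemma cycle_rel_sym (n : nat) : symmetric (@cycle_rel n).
Proof. by move=> i j; rewrite /cycle_rel eq_sym orbC. Qed.

Lemma cycle_rel_irrefl (n : nat) : irreflexive (@cycle_rel n).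
Proof. by move=> i; rewrite /cycle_rel eqxx. Qed.

Definition cycle_graph (n : nat) : sgraph :=
  SGraph (@cycle_rel_sym n) (@cycle_rel_irrefl n).

(* Main.v *)
(* A proper subgraph of a cycle misses an edge, so it lies in a path, and the
   colorings 0101... and 0102 0102 ... of a path bound its chiS by 2 or 3. These
   bounds are attained by the Hamiltonian path, so criticality amounts to C_n
   not being S-packing colorable with as few colors as that path: in (i) C_n
   must not be bipartite, in (ii) n must not be a sum of blocks 012 and 0102,
   and in (iii) n must not be a sum of blocks 0102. The exception is n = 3,
   where the path has only three vertices and is colored 010. *)

Require Import Defs.
From mathcomp Require Import all_boot.
From mathcomp Require Import zify.
Set Implicit Arguments.
Unset Strict Implicit.
Unset Printing Implicit Defensive.

Ltac split_ifs := repeat match goal with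
  | |- context [if ?b then _ else _] => case: (boolP b) => ?
  end.

(** * Distances in terms of walks *)

Lemma gdist_gt_walk (G : sgraph) (u : G) (p : seq G) (s : nat) :
  path (@sedge G) u p -> gdist_gt u (last u p) s -> s < size p.
Proof.
move=> up; rewrite /gdist_gt /gdist.
have -> : connect (@sedge G) u (last u p) by apply/connectP; exists p.
move=> /leq_trans; apply; rewrite leqNgt; apply/negP => lt_find.
have szp : size p < #|G|.
  by apply: leq_trans lt_find _; rewrite -[X in _ <= X](size_iota 0) find_size.
have := before_find 0 lt_find; rewrite nth_iota // add0n.
by case/existsP; exists (in_tuple p); rewrite up eqxx.
Qed.

Lemma walk_gdist_gt (G : sgraph) (u v : G) (s : nat) :
  (forall p, path (@sedge G) u p -> last u p = v -> s < size p) ->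
  gdist_gt u v s.
Proof.
move=> walk_gt; rewrite /gdist_gt /gdist; case: ifP => // /connectP[p up v_eq].
(* A repetition-free walk is shorter than [#|G|], so the bounded search in [gdist] does find a
   length. *)
rewrite {v}v_eq in walk_gt *; case/shortenP: up walk_gt => q uq Uq _ walk_gt.
have szq : size q < #|G| by have := max_card (mem (u :: q)); rewrite (card_uniqP Uq).
have walk_q : has (has_walk u (last u q)) (iota 0 #|G|).
  apply/hasP; exists (size q); first by rewrite mem_iota.
  by apply/existsP; exists (in_tuple q); rewrite uq eqxx.
have := nth_find 0 walk_q; have := walk_q; rewrite has_find size_iota => lt_find.
rewrite nth_iota // add0n => /existsP[r /andP[ur /eqP last_r]].
by rewrite -[X in _ < X](size_tuple r); apply: walk_gt.
Qed.

(** A potential that rises by at most one per edge rises along a walk by at most its length. This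
    gives lower bounds on distances without computing them. *)
Lemma lipschitz_gdist_gt (G : sgraph) (phi : G -> nat) (u v : G) (s : nat) :
  (forall x y : G, sedge x y -> phi y <= (phi x).+1) ->
  phi u + s < phi v -> gdist_gt u v s.
Proof.
move=> lip lt_phi; apply: walk_gdist_gt => p up last_p.
suff : phi v <= phi u + size p by lia.
rewrite -last_p; elim: p u up {lt_phi last_p} => [|x p IHp] u /=; first by lia.
by case/andP=> /lip ux /IHp; lia.
Qed.

Lemma packing_coloring_walk (S : nat -> nat) (G : sgraph) (m : nat)
    (c : {ffun G -> 'I_m}) (h : nat -> G) (i k : nat) :
  packing_coloring S c ->
  (forall j, i <= j < i + k -> sedge (h j) (h j.+1)) ->
  h i != h (i + k) -> c (h i) = c (h (i + k)) -> S (c (h i)) < k.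
Proof.
move=> /forallP/(_ (h i))/forallP/(_ (h (i + k)))/implyP c_pack h_edge h_neq h_eq.
have {c_pack} : gdist_gt (h i) (h (i + k)) (S (c (h i))).
  by apply: c_pack; rewrite h_neq h_eq eqxx.
have -> : h (i + k) = last (h i) [seq h j | j <- iota i.+1 k].
  by rewrite last_map; congr h; elim: k i {h_edge h_neq h_eq} => [|k IHk] i //=;
    [rewrite addn0 | rewrite -IHk addSnnS].
move=> /gdist_gt_walk; rewrite size_map size_iota; apply.
elim: k i h_edge {h_neq h_eq} => [|k IHk] i h_edge //=.
rewrite h_edge ?IHk // => [j j_in|]; last by lia.
by apply: h_edge; lia.
Qed.

Lemma chiS_gt (S : nat -> nat) (G : sgraph) (m : nat) :
  (forall k (c : {ffun G -> 'I_k}), packing_coloring S c -> m < k) ->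
  m < chiS S G.
Proof.
by move=> m_lt; rewrite /chiS; case: ex_minnP => k /existsP[c /m_lt].
Qed.

Lemma chiS_leq (S : nat -> nat) (G : sgraph) (m : nat) (f : G -> nat) :
  (forall x, f x < m) ->
  (forall x y, x != y -> f x = f y -> gdist_gt x y (S (f x))) ->
  chiS S G <= m.
Proof.
move=> f_lt f_pack; rewrite /chiS; case: ex_minnP => k _; apply.
apply/existsP; exists [ffun x => Ordinal (f_lt x)].
apply/forallP => x; apply/forallP => y; apply/implyP => /andP[xy].
by rewrite !ffunE -val_eqE /= => /eqP; apply: f_pack.
Qed.

(** * Upper bounds from colorings given as sequences *)

Lemma val_ordS (n : nat) (i : 'I_n) :
  val (ordS i) = if i.+1 == n then 0 else i.+1.
Proof.
rewrite /=; case: eqP => [->|]; first by rewrite modnn.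
by move=> /eqP i_neq; rewrite modn_small // ltn_neqAle i_neq ltn_ord.
Qed.

(** The two arcs joining [i] and [j] have lengths [j - i] and [n - (j - i)]. *)
Lemma chiS_cycle_leq (S : nat -> nat) (n m : nat) (f : nat -> nat) :
  (forall i, i < n -> f i < m) ->
  (forall i j, i < j < n -> f i = f j -> S (f i) < j - i /\ S (f i) < n - (j - i)) ->
  chiS S (cycle_graph n) <= m.
Proof.
move=> f_lt f_pack; apply: (@chiS_leq S (cycle_graph n) m (f \o val)) => [x|x y].
  exact/f_lt/ltn_ord.
rewrite /= -val_eqE /= => xy fxy.
(* The potential [minn (d z) (n - d z)] is the cyclic distance from [x] to [z]. *)
pose d (z : nat) := if z < x then x - z else z - x.
apply: (@lipschitz_gdist_gt (cycle_graph n) (fun z : 'I_n => minn (d z) (n - d z))) => [z t|].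
  rewrite /= /cycle_rel -!val_eqE !val_ordS /d /=.
  by have := ltn_ord z; have := ltn_ord t; have := ltn_ord x; split_ifs; lia.
have x_lt := ltn_ord x; have y_lt := ltn_ord y; rewrite /d /=.
have [lt_xy|lt_yx|eq_xy] := ltngtP (x : nat) y.
- by have [] := f_pack x y _ fxy; split_ifs; lia.
- by have [] := f_pack y x _ (esym fxy); rewrite -?fxy; split_ifs; lia.
- by rewrite eq_xy eqxx in xy.
Qed.

(** A missing vertex [a] also loses the edge to its successor. *)
Lemma proper_subgraph_cycle_missing_edge (n : nat) (H : subgraph (cycle_graph n)) :
  proper_subgraph H -> exists a : 'I_n, ~~ sub_edge H a (ordS a).
Proof.
case/orP => [|/existsP[x /existsP[y /andP[/andP[_ /orP[]/eqP ->] xyN]]]].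
- rewrite eqEsubset subsetT /= => /subsetPn[a _ aN].
  by exists a; apply: contra aN => /sub_edge_in/and3P[].
- by exists x.
- by exists y; rewrite sub_edge_sym.
Qed.

(* Cutting the cycle at a missing edge {a, a + 1} numbers its vertices along a
   path starting at a + 1, and no walk of H can shortcut this path. *)
Lemma chiS_proper_subgraph_cycle_leq (S : nat -> nat) (n m : nat) (g : nat -> nat)
    (H : subgraph (cycle_graph n)) :
  proper_subgraph H ->
  (forall i, i < n -> g i < m) ->
  (forall i j, i < j < n -> g i = g j -> S (g i) < j - i) ->
  chiS S (graph_of_subgraph H) <= m.
Proof.
move=> /proper_subgraph_cycle_missing_edge[a aN] g_lt g_pack.
have a_lt := ltn_ord a.
(* The successor of [a] gets position 0 and [a] itself position [n - 1]. *)
pose pos (x : graph_of_subgraph H) : nat :=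
  if a < val x then val x - a.+1 else val x + n - a.+1.
have pos_lt x : pos x < n.
  by rewrite /pos; have := ltn_ord (val x); split_ifs; lia.
have pos_inj x y : pos x = pos y -> x = y.
  move=> eq_pos; apply/val_inj/val_inj; move: eq_pos.
  by have := ltn_ord (val x); have := ltn_ord (val y); rewrite /pos /=; split_ifs; lia.
have pos_edge (x y : graph_of_subgraph H) : sedge x y -> pos y <= (pos x).+1.
  rewrite /= /sub_rel => xy; case/and3P: (sub_edge_in xy) => _ _ /=.
  rewrite /cycle_rel => /andP[_] xy_succ.
  have xNa : val x = a -> val y = ordS a -> False.
    by move=> xa ya; rewrite xa ya (negPf aN) in xy.
  have yNa : val y = a -> val x = ordS a -> False.
    by move=> ya xa; rewrite xa ya sub_edge_sym (negPf aN) in xy.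
  have x_lt := ltn_ord (val x); have y_lt := ltn_ord (val y).
  have {}yNa : val y = a :> nat -> val x = (if a.+1 == n then 0 else a.+1) :> nat -> False.
    by rewrite -val_ordS => /ord_inj/yNa yN /ord_inj.
  have {}xNa : val x = a :> nat -> val y = (if a.+1 == n then 0 else a.+1) :> nat -> False.
    by rewrite -val_ordS => /ord_inj/xNa xN /ord_inj.
  move: xy_succ; rewrite -!val_eqE !val_ordS /= /pos.
  by move: xNa yNa x_lt y_lt => /=; split_ifs; lia.
apply: (@chiS_leq S _ m (g \o pos)) => [x|x y xy] /=; first exact: g_lt.
move=> gxy; have [lt_xy|lt_yx|/pos_inj eq_xy] := ltngtP (pos x) (pos y).
- by apply: (lipschitz_gdist_gt pos_edge); have := g_pack _ _ _ gxy; have := pos_lt y; lia.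
(* For a pair met in decreasing order the path is read backwards. *)
- apply: (@lipschitz_gdist_gt (graph_of_subgraph H) (fun z => n - pos z)) => [z t|].
    by rewrite sedge_sym => /pos_edge; lia.
  by have := g_pack _ _ _ (esym gxy); rewrite -gxy; have := pos_lt x; lia.
- by rewrite eq_xy eqxx in xy.
Qed.

(** * Unrolled colorings and the Hamiltonian path *)

(** Lower bounds then become arithmetic on a periodic sequence; [0 < k < n] ensures that positions
    [i] and [i + k] are distinct vertices. *)
Lemma cycle_coloring_unroll (S : nat -> nat) (n m : nat)
    (c : {ffun cycle_graph n -> 'I_m}) :
  0 < n -> packing_coloring S c ->
  exists f : nat -> nat, [/\ forall i, f i < m, forall i, f (i + n) = f i &
    forall i k, 0 < k < n -> f i = f (i + k) -> S (f i) < k].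
Proof.
case: n c => // n c _ c_pack.
pose h (i : nat) : cycle_graph n.+1 := @inord n (i %% n.+1).
have val_h i : val (h i) = i %% n.+1 by rewrite /h /= inordK ?ltn_pmod.
exists (fun i => c (h i)); split=> [i|i|i k k_in /val_inj eq_c]; first exact: ltn_ord.
  by rewrite /h modnDr.
have h_neq l j : 0 < l < n.+1 -> h j != h (j + l).
  move=> l_in; rewrite -val_eqE !val_h -[X in X == _ %[mod _]]addn0 eqn_modDl.
  by rewrite mod0n modn_small; lia.
apply: (packing_coloring_walk c_pack) (eq_c) => [j _|]; last exact: h_neq.
rewrite /= /cycle_rel -{1}[j.+1]addn1 h_neq; last by lia.
by rewrite -val_eqE /= !val_h -[(j %% _).+1]addn1 modnDml addn1 eqxx.
Qed.

Definition path_rel (n : nat) : rel 'I_n :=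
  fun i j => (j == i.+1 :> nat) || (i == j.+1 :> nat).

Lemma path_rel_sym (n : nat) : symmetric (@path_rel n).
Proof. by move=> i j; rewrite /path_rel orbC. Qed.

Lemma path_rel_cycle (n : nat) (x y : cycle_graph n) : path_rel x y ->
  [&& x \in [set: cycle_graph n], y \in [set: cycle_graph n] & sedge x y].
Proof.
rewrite !in_setT /= /path_rel /cycle_rel -!val_eqE !val_ordS /=.
by have := ltn_ord x; have := ltn_ord y; split_ifs; lia.
Qed.

Definition path_subgraph (n : nat) : subgraph (cycle_graph n) :=
  @Subgraph (cycle_graph n) setT (@path_rel n) (@path_rel_sym n) (@path_rel_cycle n).

(** The dropped edge joins [n - 1] to 0; for [n = 2] it would be an edge of the path. *)
Lemma path_subgraph_proper (n : nat) : 3 <= n -> proper_subgraph (path_subgraph n).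
Proof.
case: n => // n n_ge; apply/orP; right.
apply/existsP; exists ord_max; apply/existsP; exists ord0.
by rewrite /= /cycle_rel /path_rel -!val_eqE !val_ordS /=; split_ifs; lia.
Qed.

Lemma path_subgraph_coloring_unroll (S : nat -> nat) (n m : nat)
    (c : {ffun graph_of_subgraph (path_subgraph n) -> 'I_m}) :
  0 < n -> packing_coloring S c ->
  exists f : nat -> nat, (forall i, f i < m) /\
    forall i k, 0 < k -> i + k < n -> f i = f (i + k) -> S (f i) < k.
Proof.
case: n c => // n c _ c_pack.
pose h (i : nat) : graph_of_subgraph (path_subgraph n.+1) :=
  exist _ (inord i) (in_setT (inord i : 'I_n.+1)).
have val_h i : i < n.+1 -> val (val (h i)) = i by move=> i_lt; rewrite /= inordK.
exists (fun i => c (h i)); split=> [i|i k k_gt ik_lt /val_inj eq_c]; first exact: ltn_ord.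
apply: (packing_coloring_walk c_pack) (eq_c) => [j j_in|].
  by rewrite /= /sub_rel /= /path_rel !inordK ?eqxx //; lia.
by rewrite -!val_eqE !val_h; lia.
Qed.

(** The Hamiltonian path is the only subgraph on which the forward implications test criticality. *)
Lemma critical_path_subgraph_lt (S : nat -> nat) (n : nat) : 3 <= n ->
  chiS_critical S (cycle_graph n) ->
  chiS S (graph_of_subgraph (path_subgraph n)) < chiS S (cycle_graph n).
Proof.
move=> n_ge; apply; last exact: path_subgraph_proper.
by apply/set0Pn; exists (Ordinal (ltnW (ltnW n_ge))); rewrite in_setT.
Qed.

Definition pattern0102 (i : nat) : nat :=
  if odd i then (if i %% 4 == 1 then 1 else 2) else 0.

(** As 4 is 1 modulo 3, the length left after [n %% 3] blocks 0102 is a multiple of 3 whenever those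
    blocks fit. *)
Definition pattern012 (n i : nat) : nat :=
  if i < 4 * (n %% 3) then pattern0102 i else (i - 4 * (n %% 3)) %% 3.

(** * Lower bounds for the Hamiltonian path and the cycle *)

Section LowerBounds.
Variables (S : nat -> nat) (n : nat).
Hypotheses (hn : 3 <= n) (S_gt0 : forall i, 0 < S i).

Lemma chiS_path_subgraph_gt1 : 1 < chiS S (graph_of_subgraph (path_subgraph n)).
Proof.
apply: chiS_gt => k c /path_subgraph_coloring_unroll[|f [f_lt f_pack]]; first by lia.
have := f_pack 0 1; rewrite add0n; have := f_lt 0; have := f_lt 1; have := S_gt0 (f 0).
by lia.
Qed.

(** Two colors would alternate on the first four vertices, putting color 1 on two vertices at
    distance 2. *)
Lemma chiS_path_subgraph_gt2 : 4 <= n -> 2 <= S 1 ->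
  2 < chiS S (graph_of_subgraph (path_subgraph n)).
Proof.
move=> n_ge S1; apply: chiS_gt => k c.
case/path_subgraph_coloring_unroll=> [|f [f_lt f_pack]]; first by lia.
rewrite ltnNge; apply/negP => k_le.
have f_lt2 i : f i < 2 by apply: leq_trans (f_lt i) k_le.
have f_adj i : i.+1 < n -> f i <> f i.+1.
  by move=> i_lt; have := f_pack i 1; rewrite addn1; have := S_gt0 (f i); lia.
have f_two i : i.+2 < n -> f i = 1 -> f i.+2 <> 1.
  by move=> i_lt fi; have := f_pack i 2; rewrite addn2 fi; lia.
have := f_adj 0; have := f_adj 1; have := f_adj 2; have := f_two 0; have := f_two 1.
by have := f_lt2 0; have := f_lt2 1; have := f_lt2 2; have := f_lt2 3; lia.
Qed.

Lemma chiS_cycle_odd_gt2 : odd n -> 2 < chiS S (cycle_graph n).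
Proof.
move=> n_odd; apply: chiS_gt => k c.
case/cycle_coloring_unroll=> [|f [f_lt f_per f_pack]]; first by lia.
rewrite ltnNge; apply/negP => k_le.
have f_lt2 i : f i < 2 by apply: leq_trans (f_lt i) k_le.
have f_adj i : f i <> f i.+1.
  by have := f_pack i 1; rewrite addn1; have := S_gt0 (f i); lia.
(* Two colors must alternate, which contradicts periodicity after an odd number [n] of steps. *)
have f_parity i : odd (f i) = odd (f 0 + i).
  elim: i => [|i IHi]; first by rewrite addn0.
  by have := f_lt2 i; have := f_lt2 i.+1; have := f_adj i; lia.
by have := f_parity n; have := f_per 0; rewrite add0n; lia.
Qed.

(** Distances in the 5-cycle are at most 2, so colors 1 and 2 occur at most once each and color 0 at
    most twice: only four vertices are covered. *)
Lemma chiS_cycle5_gt3 : n = 5 -> 2 <= S 1 -> 2 <= S 2 -> 3 < chiS S (cycle_graph n).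
Proof.
move=> n5 S1 S2; apply: chiS_gt => k c.
case/cycle_coloring_unroll=> [|f [f_lt f_per f_pack]]; first by lia.
rewrite ltnNge; apply/negP => k_le.
have f_lt3 i : f i < 3 by apply: leq_trans (f_lt i) k_le.
have f_adj i : f i <> f i.+1.
  by have := f_pack i 1; rewrite addn1; have := S_gt0 (f i); lia.
have f_two i : 0 < f i -> f i <> f i.+2.
  move=> fi; have := f_pack i 2; rewrite addn2; have := f_lt3 i.
  by case: (f i) fi => [|[|[|]]] //; lia.
have := (f_lt3 0, f_lt3 1, f_lt3 2, f_lt3 3, f_lt3 4).
have := (f_adj 0, f_adj 1, f_adj 2, f_adj 3, f_adj 4).
have := (f_two 0, f_two 1, f_two 2, f_two 3, f_two 4).
have f5 : f 5 = f 0 by rewrite -(f_per 0) n5.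
have f6 : f 6 = f 1 by rewrite -(f_per 1) n5.
rewrite f5 f6; move=> [[[[]]]] + + + + + [[[[]]]] + + + + + [[[[]]]]; lia.
Qed.

(* Four consecutive vertices cannot all avoid color 2, while color 2 needs gaps
   of at least 4; hence color 2 recurs with period exactly 4. *)
Lemma chiS_cycle_gt3 : n %% 4 != 0 -> 4 <= n -> 2 <= S 1 -> 3 <= S 2 ->
  3 < chiS S (cycle_graph n).
Proof.
move=> n_mod n_ge S1 S2; apply: chiS_gt => k c.
case/cycle_coloring_unroll=> [|f [f_lt f_per f_pack]]; first by lia.
rewrite ltnNge; apply/negP => k_le.
have f_lt3 i : f i < 3 by apply: leq_trans (f_lt i) k_le.
have f_adj i : f i <> f i.+1.
  by have := f_pack i 1; rewrite addn1; have := S_gt0 (f i); lia.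
have f_two i : f i = 1 -> f i.+2 <> 1.
  by move=> fi; have := f_pack i 2; rewrite addn2 fi; lia.
have f_gap i j : 0 < j < 4 -> f i = 2 -> f (i + j) <> 2.
  by move=> j_in fi; have := f_pack i j; rewrite fi; lia.
have f_window i : [\/ f i = 2, f i.+1 = 2, f i.+2 = 2 | f i.+3 = 2].
  have := (f_lt3 i, f_lt3 i.+1, f_lt3 i.+2, f_lt3 i.+3).
  have := (f_adj i, f_adj i.+1, f_adj i.+2, f_two i, f_two i.+1).
  move=> [[[[]]]] + + + + + [[[]]] + + + +.
  have [->|?] := eqVneq (f i) 2; first by constructor 1.
  have [->|?] := eqVneq (f i.+1) 2; first by constructor 2.
  have [->|?] := eqVneq (f i.+2) 2; first by constructor 3.
  by constructor 4; lia.
have f_next i : f i = 2 -> f (i + 4) = 2.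
  move=> fi; have := f_gap i 1 _ fi; have := f_gap i 2 _ fi; have := f_gap i 3 _ fi.
  rewrite addn1 addn2 addn3 addn4 => f3 f2 f1.
  by have [/f1|/f2|/f3|] := f_window i.+1 => // H; case: H.
have [i fi] : exists i, f i = 2 by case: (f_window 0); [exists 0|exists 1|exists 2|exists 3].
have f_period q : f (i + 4 * q) = 2.
  by elim: q => [|q IHq]; rewrite ?muln0 ?addn0 // mulnS addnCA addnC f_next.
(* Going from [i] to the first multiple of 4 beyond [n] and then back by one period [n] gives two
   occurrences of color 2 with a gap between 1 and 3. *)
apply: (f_gap i (4 - n %% 4) _ fi); first by lia.
rewrite -f_per -[RHS](f_period (n %/ 4).+1); congr f; lia.
Qed.

End LowerBounds.

(** * Upper bounds for proper subgraphs and the cycle *)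

Section UpperBounds.
Variables (S : nat -> nat) (n : nat).

Lemma chiS_proper_subgraph_leq2 (H : subgraph (cycle_graph n)) :
  S 0 = 1 -> S 1 = 1 \/ n = 3 -> proper_subgraph H ->
  chiS S (graph_of_subgraph H) <= 2.
Proof.
move=> S0 S1 H_proper.
apply: (chiS_proper_subgraph_cycle_leq (g := modn^~ 2) H_proper) => [i _|i j j_lt].
  exact: (@ltn_pmod i 2).
case: S1 => [S1|n3] eq_ij; last first.
  (* On three vertices the word is 010, so only color 0 repeats. *)
  have [-> ->] : i = 0 /\ j = 2 by lia.
  by rewrite S0.
have : S (i %% 2) = 1 by have [->|->] : i %% 2 = 0 \/ i %% 2 = 1 by lia.
lia.
Qed.

(** In the pattern color 0 recurs at gap 2 and colors 1 and 2 at gap 4, hence the bounds 1 and 3. *)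
Lemma S_pattern0102 (i : nat) : S 0 = 1 -> S 1 <= 3 -> S 2 <= 3 ->
  S (pattern0102 i) <= (if odd i then 3 else 1).
Proof. by rewrite /pattern0102; case: odd => [|->] //; case: eqP. Qed.

Lemma chiS_proper_subgraph_leq3 (H : subgraph (cycle_graph n)) :
  S 0 = 1 -> S 1 <= 3 -> S 2 <= 3 -> proper_subgraph H ->
  chiS S (graph_of_subgraph H) <= 3.
Proof.
move=> S0 S1 S2 H_proper.
apply: (chiS_proper_subgraph_cycle_leq (g := pattern0102) H_proper) => [i _|i j j_lt].
  by rewrite /pattern0102; split_ifs; lia.
have := S_pattern0102 i S0 S1 S2; rewrite /pattern0102; split_ifs; lia.
Qed.

Lemma chiS_cycle_even_leq2 : S 0 = 1 -> S 1 = 1 -> ~~ odd n ->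
  chiS S (cycle_graph n) <= 2.
Proof.
move=> S0 S1 n_even; apply: (@chiS_cycle_leq S n 2 (modn^~ 2)) => [i _|i j j_lt].
  exact: (@ltn_pmod i 2).
have : S (i %% 2) = 1 by have [->|->] : i %% 2 = 0 \/ i %% 2 = 1 by lia.
lia.
Qed.

Lemma chiS_cycle_mod4_leq3 : S 0 = 1 -> S 1 <= 3 -> S 2 <= 3 -> n %% 4 = 0 ->
  chiS S (cycle_graph n) <= 3.
Proof.
move=> S0 S1 S2 n_mod; apply: (@chiS_cycle_leq S n 3 pattern0102) => [i _|i j j_lt].
  by rewrite /pattern0102; split_ifs; lia.
have := S_pattern0102 i S0 S1 S2; rewrite /pattern0102; split_ifs; lia.
Qed.

(* Every n >= 3 other than 5 is 3 a + 4 b with b = n %% 3, which leaves room for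
   b blocks 0102 followed by a blocks 012. *)
Lemma chiS_cycle_leq3 : 3 <= n -> S 0 = 1 -> S 1 = 2 -> S 2 = 2 -> n <> 5 ->
  chiS S (cycle_graph n) <= 3.
Proof.
move=> n_ge S0 S1 S2 n5; apply: (@chiS_cycle_leq S n 3 (pattern012 n)) => [i _|i j j_lt].
  by rewrite /pattern012 /pattern0102; split_ifs; lia.
have : S (pattern012 n i) = (if pattern012 n i == 0 then 1 else 2).
  have : pattern012 n i < 3 by rewrite /pattern012 /pattern0102; split_ifs; lia.
  by case: (pattern012 n i) => [|[|[|]]].
(* Both blocks begin with 01, end with 2 and contain 1 and 2 once, so around the cycle these colors
   recur at gaps of at least 3 and 0 is never adjacent to 0. *)
move=> ->; rewrite /pattern012 /pattern0102; split_ifs; lia.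
Qed.

End UpperBounds.

(** * Criticality of cycles *)

Theorem theorem4p3 (n : nat) (S : nat -> nat)
    (hn : 3 <= n) (hS : packing_sequence S) :
  [/\ (S 0 = 1 -> S 1 = 1 ->
         (chiS_critical S (cycle_graph n) <-> odd n)),
      (S 0 = 1 -> S 1 = 2 -> S 2 = 2 ->
         (chiS_critical S (cycle_graph n) <-> n = 3 \/ n = 5)) &
      (S 0 = 1 -> 2 <= S 1 <= 3 -> S 2 = 3 ->
         (chiS_critical S (cycle_graph n) <-> n <> 0 %[mod 4]))].
Proof.
have [S_gt0 _] := hS; split=> [S0 S1|S0 S1 S2|S0 /andP[S1 S1'] S2]; split.
- move=> /critical_path_subgraph_lt-/(_ hn) lt_chi; apply/negPn/negP => n_even.
  have := chiS_path_subgraph_gt1 hn S_gt0.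
  by have := chiS_cycle_even_leq2 S0 S1 n_even; lia.
- move=> n_odd H _ H_proper.
  apply: leq_ltn_trans (chiS_cycle_odd_gt2 hn S_gt0 n_odd).
  by apply: chiS_proper_subgraph_leq2 => //; left.
- move=> /critical_path_subgraph_lt-/(_ hn) lt_chi.
  have [->|n3] := eqVneq n 3; first by left.
  right; apply/eqP/negPn/negP => /eqP n5.
  have n4 : 4 <= n by lia.
  have := chiS_path_subgraph_gt2 hn S_gt0 n4 (eq_leq (esym S1)).
  by have := chiS_cycle_leq3 hn S0 S1 S2 n5; lia.
- move=> n35 H _ H_proper; case: n35 => n_eq.
    (* The triangle is separated by the bounds 2 and 3, the 5-cycle by 3 and 4. *)
    apply: (@leq_ltn_trans 2); first by apply: chiS_proper_subgraph_leq2 => //; right.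
    by apply: chiS_cycle_odd_gt2 => //; rewrite n_eq.
  apply: (@leq_ltn_trans 3); first by apply: chiS_proper_subgraph_leq3 => //; rewrite ?S1 ?S2.
  by apply: chiS_cycle5_gt3 => //; rewrite ?S1 ?S2.
- move=> /critical_path_subgraph_lt-/(_ hn) lt_chi; rewrite mod0n => n_mod.
  have n4 : 4 <= n by lia.
  have := chiS_path_subgraph_gt2 hn S_gt0 n4 S1.
  by have := chiS_cycle_mod4_leq3 S0 S1' (eq_leq S2) n_mod; lia.
- rewrite mod0n => /eqP n_mod H _ H_proper.
  have [n3|n3] := eqVneq n 3.
    apply: (@leq_ltn_trans 2); first by apply: chiS_proper_subgraph_leq2 => //; right.
    by apply: chiS_cycle_odd_gt2 => //; rewrite n3.
  apply: (@leq_ltn_trans 3); first by apply: chiS_proper_subgraph_leq3 => //; rewrite S2.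
  by apply: chiS_cycle_gt3 => //; [lia | rewrite S2].
Qed.
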